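(* Let $U$ be an $n\times n$ complex unitary matrix with eigenvalues $(\xi_j)_{j=1}^n$, repeated according to multiplicity. Then $\operatorname{diag}(\bar\xi_1,\bar\xi_2,\ldots,\bar\xi_n)\in\mathfrak{O}_c(U)$ if and only if there is an ordered orthonormal basis $(\mathbf{u}_j)_{j=1}^n$ for $\mathbb{C}^n$ with $U\mathbf{u}_j=\xi_j\mathbf{u}_j$ for all $1\le j\le n$ and such that the unitary matrix $V=[\mathbf{u}_1|\mathbf{u}_2|\cdots|\mathbf{u}_n]$ satisfies $V^t=V$.
   Context: A conjugation on a complex Hilbert space is an antilinear, isometric map $C$ with $C^2=I$. For a unitary operator $U$ on a complex Hilbert space $\mathcal{H}$, the conjugate orbit is $\mathfrak{O}_c(U)=\{CUC: C \text{ a conjugation on } \mathcal{H}\}$. An $n\times n$ unitary matrix is viewed as a unitary operator on $\mathbb{C}^n$ (column vectors, standard inner product) by $\mathbf{x}\mapsto U\mathbf{x}$; $V^t$ denotes the transpose of $V$. *)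

(* Defs.v *)
From HB Require Import structures.
From mathcomp Require Import all_boot all_order all_algebra.
From mathcomp Require Import complex.
From mathcomp Require Import boolp classical_sets reals.

Set Implicit Arguments.
Unset Strict Implicit.
Unset Printing Implicit Defensive.

Import GRing.Theory Num.Theory.
Local Open Scope ring_scope.
Local Open Scope classical_set_scope.

(* [dotmx] is stated for row vectors, hence the transpositions. The form is
   linear in its first argument and antilinear in the second. *)
Definition cdot (R : realType) (n : nat) (x y : 'cV[R[i]]_n) : R[i] :=
  dotmx x^T y^T.

Definition cnorm (R : realType) (n : nat) (x : 'cV[R[i]]_n) : R[i] :=
  sqrtC (cdot x x).

Definition antilinear (R : realType) (n : nat)
    (C : 'cV[R[i]]_n -> 'cV[R[i]]_n) : Prop :=
  forall (a b : R[i]) (x y : 'cV[R[i]]_n),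
    C (a *: x + b *: y) = a^* *: C x + b^* *: C y.

Definition isometric (R : realType) (n : nat)
    (C : 'cV[R[i]]_n -> 'cV[R[i]]_n) : Prop :=
  forall x : 'cV[R[i]]_n, cnorm (C x) = cnorm x.

Definition conjugation (R : realType) (n : nat)
    (C : 'cV[R[i]]_n -> 'cV[R[i]]_n) : Prop :=
  [/\ antilinear C, isometric C & involutive C].

Definition conjugate_orbit (R : realType) (n : nat)
    (T : 'cV[R[i]]_n -> 'cV[R[i]]_n) : set ('cV[R[i]]_n -> 'cV[R[i]]_n) :=
  [set C \o T \o C | C in @conjugation R n].

Definition mxop (R : realType) (n : nat) (A : 'M[R[i]]_n) :
    'cV[R[i]]_n -> 'cV[R[i]]_n :=
  fun x => A *m x.

(* For unitary matrices algebraic and geometric multiplicities agree. *)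
Definition eigenvalues_of (R : realType) (n : nat) (A : 'M[R[i]]_n)
    (xi : 'I_n -> R[i]) : Prop :=
  char_poly A = \prod_(j < n) ('X - (xi j)%:P).

Definition orthonormal_basis (R : realType) (n : nat)
    (u : 'I_n -> 'cV[R[i]]_n) : Prop :=
  (forall j k : 'I_n, cdot (u j) (u k) = (j == k)%:R) /\
  basis_of fullv [tuple u j | j < n].

Definition mx_of_columns (R : realType) (n : nat) (u : 'I_n -> 'cV[R[i]]_n) :
    'M[R[i]]_n :=
  \matrix_(i < n, j < n) u j i 0.

(* Main.v *)
(* The columns of V are u_j = C e_j. An antilinear isometry satisfies
   <C x, C y> = <y, x>, so these columns are orthonormal, and C^2 = I gives
   V_ij = <C e_j, C (C e_i)> = <C e_i, e_j> = V_ji. Conversely, for V unitary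
   and symmetric, V times its entrywise conjugate is V V^* = I, so
   C x = V (conj x) is a conjugation; it sends e_j to u_j, which turns
   C U C e_j = conj xi_j e_j into U u_j = xi_j u_j and back. *)
Require Import Defs.
From HB Require Import structures.
From mathcomp Require Import all_boot all_order all_algebra.
From mathcomp Require Import complex.
From mathcomp Require Import boolp classical_sets reals.
Import GRing.Theory Num.Theory.
Local Open Scope ring_scope.

Lemma cdotE (R : realType) (n : nat) (x y : 'cV[R[i]]_n) :
  cdot x y = \sum_k x k 0 * (y k 0)^*.
Proof. by rewrite /cdot dotmxE mxE; apply: eq_bigr => k _; rewrite !mxE. Qed.

Lemma cdotDl (R : realType) (n : nat) (x y z : 'cV[R[i]]_n) :
  cdot (x + y) z = cdot x z + cdot y z.
Proof.
by rewrite !cdotE -big_split; apply: eq_bigr => k _; rewrite mxE mulrDl.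
Qed.

Lemma cdotZl (R : realType) (n : nat) (a : R[i]) (x z : 'cV[R[i]]_n) :
  cdot (a *: x) z = a * cdot x z.
Proof.
by rewrite !cdotE mulr_sumr; apply: eq_bigr => k _; rewrite mxE mulrA.
Qed.

Lemma cdotC (R : realType) (n : nat) (x y : 'cV[R[i]]_n) :
  cdot x y = (cdot y x)^*.
Proof.
rewrite !cdotE raddf_sum; apply: eq_bigr => k _.
by rewrite /= rmorphM /= conjCK mulrC.
Qed.

Lemma cdotDr (R : realType) (n : nat) (x y z : 'cV[R[i]]_n) :
  cdot x (y + z) = cdot x y + cdot x z.
Proof. by rewrite cdotC cdotDl rmorphD /= -!cdotC. Qed.

Lemma cdotZr (R : realType) (n : nat) (a : R[i]) (x y : 'cV[R[i]]_n) :
  cdot x (a *: y) = a^* * cdot x y.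
Proof. by rewrite cdotC cdotZl rmorphM /= -cdotC. Qed.

Lemma cdot_deltar (R : realType) (n : nat) (x : 'cV[R[i]]_n) (k : 'I_n) :
  cdot x (delta_mx k 0) = x k 0.
Proof.
rewrite cdotE (bigD1 k) //= big1 => [|j neq_jk].
  by rewrite mxE !eqxx rmorph1 mulr1 addr0.
by rewrite mxE (negPf neq_jk) rmorph0 mulr0.
Qed.

(** Pairing a vanishing combination with [u k] isolates the coefficient [c k], so the family is
    free; [n] free vectors fill a space of dimension [n]. *)
Lemma orthonormal_basisP (R : realType) (n : nat) (u : 'I_n -> 'cV[R[i]]_n) :
  (forall j k : 'I_n, cdot (u j) (u k) = (j == k)%:R) -> orthonormal_basis u.
Proof.
move=> u_on; split=> //.
rewrite basisEfree subvf dimvf dim_matrix mulr1 size_tuple leqnn !andbT.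
apply/freeP => c sum0 k; have := congr1 (fun v => cdot v (u k)) sum0.
have cdot0l (v : 'cV[R[i]]_n) : cdot 0 v = 0.
  by rewrite -(scale0r 0) cdotZl mul0r.
rewrite cdot0l (big_morph (fun v => cdot v (u k)) (id1 := 0) (op1 := +%R)) //;
  last by move=> x y; rewrite cdotDl.
rewrite (bigD1 k) //= big1 => [|j neq_jk].
  by rewrite nth_mktuple cdotZl u_on eqxx mulr1 addr0.
by rewrite nth_mktuple cdotZl u_on (negPf neq_jk) mulr0.
Qed.

(** Shape of two expanded squared norms: [p] and [q] are the diagonal terms. The swap of [c] and [d]
    pairs the terms linear in the scalar, since antilinearity exchanges the two cross terms. *)
Lemma eq_outer_addrI (V : zmodType) (p q a b c d : V) :
  p + a + (b + q) = p + c + (d + q) -> a + b = d + c.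
Proof.
rewrite -!addrA => /addrI; rewrite !addrA => /addIr e.
by rewrite e addrC.
Qed.

(** [z = 1] gives the sum of the two unknowns and [z = 'i] their difference; adding the two
    equations gives twice the first unknown. *)
Lemma polarization_eq (F : numClosedFieldType) (a b c d : F) :
  (forall z : F, z^* * z = 1 -> z * a + z^* * b = z * c + z^* * d) -> a = c.
Proof.
move=> polar.
have e1 : a + b = c + d by have := polar 1; rewrite rmorph1 !mul1r; apply.
have e2 : a - b = c - d.
  have := polar 'i; rewrite conjCi !mulNr mulCii opprK -!mulrBr => /(_ erefl).
  exact/mulfI/neq0Ci.
have dbl (x y : F) : x *+ 2 = (x + y) + (x - y).
  by rewrite mulr2n addrACA subrr addr0.
by apply: (pmulrnI (isT : (0 < 2)%N)); rewrite (dbl a b) (dbl c d) e1 e2.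
Qed.

Lemma antilinear_isometric_cdot (R : realType) (n : nat)
    (C : 'cV[R[i]]_n -> 'cV[R[i]]_n) (x y : 'cV[R[i]]_n) :
  antilinear C -> isometric C -> cdot (C x) (C y) = cdot y x.
Proof.
move=> Canti Ciso.
have sq z : cdot (C z) (C z) = cdot z z by apply: sqrtC_inj; exact: Ciso.
(* Expand the norms of [x + b y] and of its image. *)
have polar b : b^* * b = 1 ->
    b * cdot (C x) (C y) + b^* * cdot (C y) (C x)
    = b * cdot y x + b^* * cdot x y.
  move=> b1; have := sq (1 *: x + b *: y).
  rewrite Canti rmorph1 !scale1r.
  (* For [b] of modulus 1 the diagonal terms do not depend on [b] and agree on both sides, so only
     the cross terms survive. *)
  have q v : cdot (b *: v) (b *: v) = cdot v v.
    by rewrite cdotZl cdotZr mulrA [b * _]mulrC b1 mul1r.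
  have q' v : cdot (b^* *: v) (b^* *: v) = cdot v v.
    by rewrite cdotZl cdotZr conjCK mulrA b1 mul1r.
  rewrite !cdotDl !cdotDr q q' !sq !cdotZl !cdotZr conjCK.
  by move/eq_outer_addrI.
exact: polarization_eq polar.
Qed.

Lemma conjugate_orbit_symmetric_eigenbasis (R : realType) (n : nat)
    (U : 'M[R[i]]_n) (xi : 'I_n -> R[i]) :
  conjugate_orbit (mxop U) (mxop (diag_mx (\row_j (xi j)^*))) ->
  exists u : 'I_n -> 'cV[R[i]]_n,
    [/\ orthonormal_basis u,
        forall j : 'I_n, mxop U (u j) = xi j *: u j
      & (mx_of_columns u)^T = mx_of_columns u].
Proof.
case=> C [Canti Ciso CK] CUC.
exists (fun j => C (delta_mx j 0)); split.
- apply: orthonormal_basisP => j k.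
  by rewrite antilinear_isometric_cdot // cdot_deltar mxE eqxx andbT.
(* After applying the injective [C], the left side is column [j] of the diagonal matrix, and
   antilinearity turns the right side into [(xi j)^*] times the basis vector. *)
- move=> j; apply: (can_inj CK).
  have <- : mxop (diag_mx (\row_j (xi j)^*)) (delta_mx j 0)
            = C (mxop U (C (delta_mx j 0))) by rewrite -CUC.
  have := Canti (xi j) 0 (C (delta_mx j 0)) 0.
  rewrite rmorph0 !scale0r !addr0 CK => ->.
  apply/matrixP => k l; rewrite /mxop mul_diag_mx !mxE.
  by have [->|] := eqVneq k j; rewrite //= !mulr0.
- apply/matrixP => j k; rewrite !mxE -[LHS]cdot_deltar -[RHS]cdot_deltar.
  by rewrite -{1}[delta_mx k 0]CK antilinear_isometric_cdot.
Qed.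

Lemma symmetric_eigenbasis_conjugate_orbit (R : realType) (n : nat)
    (U : 'M[R[i]]_n) (xi : 'I_n -> R[i]) (u : 'I_n -> 'cV[R[i]]_n) :
  orthonormal_basis u ->
  (forall j : 'I_n, mxop U (u j) = xi j *: u j) ->
  (mx_of_columns u)^T = mx_of_columns u ->
  conjugate_orbit (mxop U) (mxop (diag_mx (\row_j (xi j)^*))).
Proof.
move=> [u_on _] Uu; set V := mx_of_columns u => Vsym.
pose cj m p (A : 'M[R[i]]_(m, p)) := map_mx Num.conj A.
have cjM m p q (A : 'M_(m, p)) (B : 'M_(p, q)) :
    cj _ _ (A *m B) = cj _ _ A *m cj _ _ B.
  exact: map_mxM.
have cjK m p : involutive (cj m p).
  by move=> A; apply/matrixP => j k; rewrite !mxE conjCK.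
(* By symmetry row [j] of [V] is the transpose of [u j], so entry [(j, k)] of the product is
   [cdot (u j) (u k)]. *)
have VcV : V *m cj _ _ V = 1%:M.
  apply/matrixP => j k; rewrite !mxE -u_on cdotE; apply: eq_bigr => l _.
  by rewrite -{1}Vsym !mxE.
have UV : U *m V = V *m diag_mx (\row_j xi j).
  apply/matrixP => j k; rewrite mul_mx_diag !mxE.
  have := congr1 (fun v : 'cV_n => v j 0) (Uu k).
  by rewrite !mxE mulrC => <-; apply: eq_bigr => l _; rewrite !mxE.
exists (fun x => V *m cj _ _ x); first split.
- by move=> a b x y; rewrite /cj map_mxD !map_mxZ mulmxDr -!scalemxAr.
- have cdotM y z : cdot y z = (y^T *m cj _ _ z) 0 0.
    by rewrite cdotE mxE; apply: eq_bigr => k _; rewrite !mxE.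
  (* Since [V] is symmetric, the factor [V *m cj _ _ V] appears in the middle and cancels; what
     remains is [cdot x x] with the factors of each term swapped. *)
  move=> x; rewrite /cnorm cdotM cjM cjK trmx_mul Vsym mulmxA.
  rewrite -[_ *m V *m _]mulmxA VcV mulmx1.
  congr (sqrtC _); rewrite mxE cdotE; apply: eq_bigr => k _.
  by rewrite !mxE mulrC.
- by move=> x; rewrite cjM cjK mulmxA VcV mul1mx.
(* Moving [U] past [V] leaves [V *m cj _ _ V] in front of the conjugated diagonal matrix, while the
   two conjugations of [x] cancel. *)
- apply/funext => x; rewrite /mxop /= mulmxA UV !cjM cjK.
  rewrite !mulmxA VcV mul1mx.
  by congr (_ *m _); apply/matrixP => j k; rewrite !mxE /= rmorphMn.
Qed.

Theorem theorem3p13 (R : realType) (n : nat) (U : 'M[R[i]]_n)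
    (xi : 'I_n -> R[i]) :
  U \is unitarymx ->
  eigenvalues_of U xi ->
  conjugate_orbit (mxop U) (mxop (diag_mx (\row_j (xi j)^*)))
  <->
  exists u : 'I_n -> 'cV[R[i]]_n,
    [/\ orthonormal_basis u,
        forall j : 'I_n, mxop U (u j) = xi j *: u j
      & (mx_of_columns u)^T = mx_of_columns u].
Proof.
move=> _ _; split; first exact: conjugate_orbit_symmetric_eigenbasis.
by case=> u [u_basis Uu Vsym]; apply: symmetric_eigenbasis_conjugate_orbit Vsym.
Qed.
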